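(* For all integers $n\geq 4$ and $k\geq 1$ with $(n,k)\neq(4,1)$, $R(kP_n,J_4)=kn+1$.
   Context: All graphs are finite and simple. For graphs $G$ and $H$, the Ramsey number $R(G,H)$ is the least natural number $N$ such that for every graph $F$ on $N$ vertices, either $F$ contains $G$ as a subgraph or the complement $\overline{F}$ contains $H$ as a subgraph. $P_n$ denotes the path on $n$ vertices, and $kP_n$ denotes the disjoint union of $k$ copies of $P_n$. For $m\geq 2$, the Jahangir graph $J_{2m}$ is the graph consisting of a cycle $C_{2m}$ together with one additional vertex adjacent to $m$ alternate vertices of $C_{2m}$; in particular $J_4$ is a $4$-cycle plus a vertex adjacent to two opposite vertices of it (i.e. $J_4\cong K_{2,3}$). *)

(* Defs.v *)
From mathcomp Require Import all_boot.

Set Implicit Arguments.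
Unset Strict Implicit.
Unset Printing Implicit Defensive.

Record sgraph := SGraph {
  vertex :> finType;
  adj : rel vertex;
  adj_sym : symmetric adj;
  adj_irr : irreflexive adj
}.

(* Not necessarily induced: non-edges of G may be sent to edges of F. *)
Definition contains_subgraph (F G : sgraph) : Prop :=
  exists f : G -> F, injective f /\ forall x y : G, adj x y -> adj (f x) (f y).

Section Complement.
Variable G : sgraph.
Definition compl_adj : rel G := [rel x y | (x != y) && ~~ adj x y].
Fact compl_sym : symmetric compl_adj.
Proof. by move=> x y; rewrite /compl_adj /= eq_sym adj_sym. Qed.
Fact compl_irr : irreflexive compl_adj.
Proof. by move=> x; rewrite /compl_adj /= eqxx. Qed.
Definition complement : sgraph := SGraph compl_sym compl_irr.
End Complement.

Section Path.
Variable n : nat.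
Definition path_adj : rel 'I_n := [rel i j : 'I_n |
  (j == i.+1 :> nat) || (i == j.+1 :> nat)].
Fact path_adj_sym : symmetric path_adj.
Proof. by move=> i j; rewrite /path_adj /= orbC. Qed.
Fact path_adj_irr : irreflexive path_adj.
Proof. by move=> i; rewrite /path_adj /= orbb ltn_eqF. Qed.
Definition path_graph : sgraph := SGraph path_adj_sym path_adj_irr.
End Path.

Section Copies.
Variables (k : nat) (G : sgraph).
Definition copies_adj : rel ('I_k * G) :=
  [rel u v | (u.1 == v.1) && adj u.2 v.2].
Fact copies_sym : symmetric copies_adj.
Proof. by move=> u v; rewrite /copies_adj /= eq_sym adj_sym. Qed.
Fact copies_irr : irreflexive copies_adj.
Proof. by move=> u; rewrite /copies_adj /= adj_irr andbF. Qed.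
Definition copies : sgraph := SGraph copies_sym copies_irr.
End Copies.

(* J_{2m}, meant for 2 <= m: the cycle C_{2m} is carried by the vertices Some i,
   with ordS the cyclic successor; None is the additional vertex, joined to the
   even-numbered vertices of the cycle. *)
Section Jahangir.
Variable m : nat.
Definition jahangir_adj : rel (option 'I_(m.*2)) := [rel u v |
  match u, v with
  | Some i, Some j => (i != j) && ((j == ordS i) || (i == ordS j))
  | None, Some i | Some i, None => ~~ odd i
  | None, None => false
  end].
Fact jahangir_sym : symmetric jahangir_adj.
Proof. by move=> [i|] [j|] //; rewrite /jahangir_adj /= eq_sym orbC. Qed.
Fact jahangir_irr : irreflexive jahangir_adj.
Proof. by move=> [i|] //; rewrite /jahangir_adj /= eqxx. Qed.
Definition jahangir : sgraph := SGraph jahangir_sym jahangir_irr.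
End Jahangir.

Definition ramsey_arrow (G H : sgraph) (N : nat) : Prop :=
  forall F : sgraph, #|F| = N ->
    contains_subgraph F G \/ contains_subgraph (complement F) H.

(* R(G, H) = N; this includes the existence of R(G, H). *)
Definition is_ramsey_number (G H : sgraph) (N : nat) : Prop :=
  ramsey_arrow G H N /\ forall M : nat, ramsey_arrow G H M -> N <= M.

(* Main.v *)
(** The upper bound: let [F] have [N >= 6] vertices and let its complement
    contain no [K_{2,3}].  Then a longest path [v1 v2 v3 .. w] of [F] misses at
    most one vertex, so it can be cut into [k] paths on [n] vertices.  Indeed
    neither end is adjacent to a missed vertex, so three missed vertices form a
    [K_{2,3}] of the complement with the two ends; hence if [x] and [y] are
    missed, the path has at least four vertices.  The common non-neighbours of
    [x] and [y] include both ends, so each of [v2] and [v3] is adjacent to [x]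
    or [y]; by maximality we may assume that [x] is adjacent to [v2] and not to
    [v3], and [y] to [v3].  Maximality then also excludes the edges [x y],
    [v1 v3] and [v1 w], so the complement joins [x] and [v1] to [y], [w], [v3].
    The lower bound: an isolated vertex next to a clique. *)

Require Import Defs.
From mathcomp Require Import all_boot.
From mathcomp Require Import zify.

Set Implicit Arguments.
Unset Strict Implicit.
Unset Printing Implicit Defensive.

(** The parts of this [K_{2,3}] of the complement are [a, b] and [c, d, e]. *)
Definition nonadj_K23 (F : sgraph) (a b c d e : F) : bool :=
  uniq [:: a; b; c; d; e] && ~~ has (fun v => adj a v || adj b v) [:: c; d; e].

Lemma nonadj_K23_jahangir (F : sgraph) (a b c d e : F) :
  nonadj_K23 a b c d e -> contains_subgraph (complement F) (jahangir 2).
Proof.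
rewrite /nonadj_K23 /= !inE !negb_or -!andbA.
case/and5P=> nab nac nad nae /and5P[nbc nbd nbe ncd] /and5P[nce nde _ ac].
case/and5P=> bc ad bd ae /andP[be _].
(* The 4-cycle alternates between the two parts. Its even positions carry [a] and [b], the
   neighbours of the centre, so the centre goes to [e]. *)
pose f (v : jahangir 2) : complement F :=
  if v is Some i then nth a [:: a; c; b; d] i else e.
exists f; split.
  have inj4 : uniq [:: a; c; b; d].
    by rewrite /= !inE !negb_or nac nab nad ncd nbd eq_sym nbc.
  have ne (i : 'I_4) : nth a [:: a; c; b; d] i != e.
    by case: i => [[|[|[|[|//]]]]].
  move=> [i|] [j|] //=.
  - by move/eqP; rewrite nth_uniq // => /eqP/val_inj ->.
  - by move/eqP; rewrite (negbTE (ne i)).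
  - by move/eqP; rewrite eq_sym (negbTE (ne j)).
move=> [[[|[|[|[|//]]]] ? ]|] [[[|[|[|[|//]]]] ?]|] //= _;
  apply/andP; split; by [|rewrite eq_sym|rewrite adj_sym].
Qed.

Lemma uniq_cat_sub (T : eqType) (t s s' : seq T) :
  uniq (t ++ s) -> uniq s' -> {subset s' <= s} -> uniq (t ++ s').
Proof.
rewrite !cat_uniq => /and3P[-> /hasPn dj _] -> sub; rewrite andbT.
by apply/hasPn=> z /sub/dj.
Qed.

(** * Longest paths when the complement has no [K_{2,3}] *)

Section LongestPath.
Variable F : sgraph.
Implicit Types s t : seq F.

Definition is_path s := uniq s && sorted (@adj F) s.

Lemma longest_path_exists :
  exists2 s, is_path s & forall t, is_path t -> size t <= size s.
Proof.
pose P l := [exists t : l.-tuple F, is_path t].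
have exP : exists l, P l by exists 0; apply/existsP; exists [tuple].
have leP l : P l -> l <= #|F|.
  case/existsP=> t /andP[/card_uniqP ct _].
  by rewrite -(size_tuple t) -ct max_card.
case: (ex_maxnP exP leP) => l /existsP[s ps] maxl.
exists s => // t pt; rewrite size_tuple; apply: maxl.
by apply/existsP; exists (in_tuple t).
Qed.

Section Maximal.
Hypothesis noK23 : forall a b c d e : F, ~~ nonadj_K23 a b c d e.
Variable s : seq F.
Hypothesis path_s : is_path s.
Hypothesis max_s : forall t, is_path t -> size t <= size s.

Lemma K23_edge (a b c d e : F) : uniq [:: a; b; c; d; e] ->
  has (fun v => adj a v || adj b v) [:: c; d; e].
Proof. by move=> u; have := noK23 a b c d e; rewrite /nonadj_K23 u negbK. Qed.

Lemma missed_vertices m : m + size s <= #|F| ->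
  exists2 t, size t = m & uniq (t ++ s).
Proof.
case/andP: path_s => us _ le_m; exists (take m (enum [predC s])).
  rewrite size_takel // -cardE.
  rewrite -(leq_add2r (size s)) (leq_trans le_m) // addnC -[leqLHS](cardC [in s]).
  by rewrite leq_add2r card_size.
rewrite cat_uniq take_uniq ?enum_uniq //= us andbT.
apply/hasPn=> x xs; apply/negP=> /mem_take.
by rewrite mem_enum !inE xs.
Qed.

Lemma adj_neq (x y : F) : adj x y -> x != y.
Proof. by apply: contraTneq => ->; rewrite adj_irr. Qed.

Lemma longest_path_two : 6 <= #|F| -> 2 <= size s.
Proof.
move=> le6; rewrite leqNgt; apply/negP=> lt2.
have no_adj (u v : F) : adj u v = false.
  apply/negP=> uv; suff: 1 < size s by lia.
  by apply: (max_s (t := [:: u; v])); rewrite /is_path /= inE adj_neq // uv.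
(* With at most one vertex on [s], the graph has no edge, and any five missed vertices form a
   [K_{2,3}] of the complement. *)
have [|t] := @missed_vertices 5; first by lia.
case: t => [|a [|b [|c [|d [|e [|//]]]]]] // _.
rewrite cat_uniq => /andP[ut _]; have := K23_edge ut.
by rewrite /= !no_adj.
Qed.

Lemma longest_path_head v p x : s = v :: p -> x \notin s -> adj x v = false.
Proof.
move=> E xs; apply/negP=> xv; suff: size (x :: s) <= size s by rewrite ltnn.
apply: max_s; case/andP: path_s => us ps.
by rewrite /is_path cons_uniq xs us /=; move: ps; rewrite E /= xv.
Qed.

Lemma longest_path_last v p x :
  s = v :: p -> x \notin s -> adj (last v p) x = false.
Proof.
move=> E xs; apply/negP=> xv.
suff: size (rcons s x) <= size s by rewrite size_rcons ltnn.
apply: max_s; case/andP: path_s => us ps.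
rewrite /is_path rcons_uniq xs us /=; move: ps.
by rewrite E /= rcons_path xv => ->.
Qed.

Lemma longest_path_four : 6 <= #|F| -> 4 <= size s.
Proof.
move=> le6; have := longest_path_two le6; case E: s => [|v [|u p]] // _.
rewrite -E leqNgt; apply/negP => lt4.
have [|t] := @missed_vertices 3; first by lia.
case: t => [|a [|b [|c [|//]]]] // _ ut.
have hd x : x \in [:: a; b; c] -> x \notin s.
  move: ut; rewrite cat_uniq => /and3P[_ /hasPn dj _] xt.
  by apply/negP=> /dj; rewrite xt.
have adF x : x \in [:: a; b; c] -> adj v x || adj (last u p) x = false.
  move=> /hd xs; rewrite adj_sym (longest_path_head E xs).
  by rewrite (longest_path_last E xs).
(* The two ends are distinct because the path has at least two vertices. *)
have ut5 : uniq [:: v; last u p; a; b; c].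
  rewrite (uniq_catC [:: v; last u p] [:: a; b; c]); apply: uniq_cat_sub ut _ _.
    have : v \notin u :: p by case/andP: path_s; rewrite E => /andP[].
    by rewrite /= mem_seq1 andbT; apply: contraNneq => ->; exact: mem_last.
  move=> z; rewrite E in_cons mem_seq1 => /orP[]/eqP->; first exact: mem_head.
  by rewrite in_cons mem_last orbT.
by have /hasP[x /adF->] := K23_edge ut5.
Qed.

Lemma longest_path_misses_one : 6 <= #|F| -> #|F| <= (size s).+1.
Proof.
move=> le6; rewrite leqNgt; apply/negP=> lt2.
have := longest_path_four le6.
case E: s => [|v1 [|v2 [|v3 [|v4 p]]]] // _.
have {lt2}[t] := @missed_vertices 2 lt2.
case: t => [|x [|y [|//]]] // _ ut.
have [us ps] := andP path_s.
set w := last v4 p.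
have wv4 : w \in v4 :: p by exact: mem_last.
have ws : w \in s by rewrite E (mem_cat w [:: v1; v2; v3]) wv4 orbT.
have v1s : v1 \in s by rewrite E mem_head.
have v2s : v2 \in s by rewrite E !inE eqxx !orbT.
have v3s : v3 \in s by rewrite E !inE eqxx !orbT.
(* As the path has at least four vertices, [w] lies beyond [v3]. *)
have uniq3 u : u = v2 \/ u = v3 -> uniq [:: v1; w; u].
  have w3 : w \in v3 :: v4 :: p by rewrite in_cons wv4 orbT.
  have w2 : w \in [:: v2, v3, v4 & p] by rewrite in_cons w3 orbT.
  move: us; rewrite E => /and4P[n1 n2 n3 _] u23.
  rewrite /= !inE !negb_or andbT -andbA; apply/and3P; split.
  - by apply: contraNneq n1 => ->.
  - by apply: contraNneq n1 => ->; case: u23 => ->; rewrite !inE eqxx ?orbT.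
  - case: u23 => ->; last by apply: contraNneq n3 => <-.
    by apply: contraNneq n2 => <-.
have uniq5 a b u : uniq ([:: a; b] ++ s) -> u = v2 \/ u = v3 ->
    uniq [:: a; b; v1; w; u].
  move=> uab u23; apply: (uniq_cat_sub (t := [:: a; b]) uab (uniq3 u u23)) => z.
  by rewrite !inE => /or3P[]/eqP-> //; case: u23 => ->.
have ends a : a \notin s -> (adj a v1 = false) * (adj a w = false).
  move=> sa; split; first exact: longest_path_head E sa.
  by rewrite adj_sym (longest_path_last E sa).
(* The missed vertices are quantified here because either of [x] and [y] may be the one adjacent to
   [v2]. *)
have key a b : uniq ([:: a; b] ++ s) -> adj a v2 -> adj a v3 || adj b v3 -> False.
  move=> uab av2 abv3.
  have sa : a \notin s.
    by move: uab; rewrite /= in_cons negb_or => /andP[/andP[]].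
  have sb : b \notin s by case/and3P: uab.
  (* Each non-edge below follows by rearranging [s] together with [[:: a]] or [[:: a; b]] into a
     path, which would be too long. *)
  have longer r t : uniq (r ++ s) -> perm_eq t (r ++ s) ->
      sorted (@adj F) t -> size r = 0.
    move=> ur pe st.
    have := max_s (t := t); rewrite /is_path st (perm_uniq pe) ur => /(_ isT).
    by rewrite (perm_size pe) size_cat -[leqRHS]add0n leq_add2r leqn0 => /eqP.
  have uas : uniq ([:: a] ++ s) by rewrite /= sa us.
  move: (ps); rewrite E /= => /and4P[a12 a23 a34 pp].
  have av3 : adj a v3 = false.
    apply/negP=> av3.
    have /(longer _ _ uas) : perm_eq [:: v1, v2, a, v3, v4 & p] ([:: a] ++ s).
      by rewrite E; exact: (permEl (perm_catCA [:: v1; v2] [:: a] _)).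
    by rewrite /= a12 [adj v2 a]adj_sym av2 av3 a34 pp => /(_ isT).
  have bv3 : adj b v3 by rewrite av3 in abv3.
  have ab : adj a b = false.
    apply/negP=> ab.
    have /(longer _ _ uab) :
        perm_eq [:: v1, v2, a, b, v3, v4 & p] ([:: a; b] ++ s).
      by rewrite E; exact: (permEl (perm_catCA [:: v1; v2] [:: a; b] _)).
    by rewrite /= a12 [adj v2 a]adj_sym av2 ab bv3 a34 pp => /(_ isT).
  (* Otherwise the path could begin with [a], [v2], [v1], [v3], [v4]. *)
  have v13 : adj v1 v3 = false.
    apply/negP=> v13.
    have /(longer _ _ uas) : perm_eq [:: a, v2, v1, v3, v4 & p] ([:: a] ++ s).
      by rewrite E perm_cons; exact: (permEl (perm_catCA [:: v2] [:: v1] _)).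
    by rewrite /= [adj v2 v1]adj_sym a12 av2 v13 a34 pp => /(_ isT).
  (* Otherwise [v1] could move to the far end, behind [w], and [a] take its place before [v2]. *)
  have v1w : adj v1 w = false.
    apply/negP=> v1w.
    have /(longer _ _ uas) :
        perm_eq (a :: rcons [:: v2, v3, v4 & p] v1) ([:: a] ++ s).
      by rewrite E perm_cons perm_rcons.
    by rewrite /= rcons_path av2 a23 a34 pp adj_sym v1w => /(_ isT).
  have u5 : uniq [:: a; v1; b; w; v3].
    rewrite (perm_uniq (_ : perm_eq _ [:: a; b; v1; w; v3])).
      by apply: uniq5 => //; right.
    by rewrite perm_cons; exact: (permEl (perm_catCA [:: v1] [:: b] _)).
  have := K23_edge u5.
  by rewrite /= ab (ends _ sa) av3 [adj v1 b]adj_sym (ends _ sb) v1w v13.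
(* Otherwise [x, y] and [v1, w, u] would be the parts of a [K_{2,3}] of the complement. *)
have nbr u : u = v2 \/ u = v3 -> adj x u || adj y u.
  move=> u23; have := K23_edge (uniq5 _ _ _ ut u23).
  have sx : x \notin s by move: ut; rewrite /= in_cons negb_or => /andP[/andP[]].
  have sy : y \notin s by case/and3P: ut.
  by rewrite /= !(ends _ sx) !(ends _ sy) /= orbF.
have xy3 := nbr v3 (or_intror erefl).
case/orP: (nbr v2 (or_introl erefl)) => [xv2|yv2]; first exact: key ut xv2 xy3.
apply: (key y x) => //; last by rewrite orbC.
by rewrite (perm_uniq (permEl (perm_catCA [:: y] [:: x] s))).
Qed.

End Maximal.

End LongestPath.

(** The path is cut into consecutive blocks of length [n]: vertex [j] of copy [i] sits at position
    [i * n + j]. Division by [n] recovers the copy, which gives injectivity. *)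
Lemma path_contains_copies (F : sgraph) (s : seq F) k n (x0 : F) :
  is_path s -> k * n <= size s -> contains_subgraph F (copies k (path_graph n)).
Proof.
case/andP=> us /(sortedP x0) ps le_kn.
have lt_idx (i : 'I_k) (j : 'I_n) : i * n + j < size s.
  apply: leq_trans le_kn; apply: leq_trans (_ : i.+1 * n <= _).
    by rewrite mulSnr ltn_add2l.
  by rewrite leq_mul2r ltn_ord orbT.
exists (fun u : copies k (path_graph n) => nth x0 s (u.1 * n + u.2)); split.
  move=> [i j] [i' j'] /= /eqP; rewrite nth_uniq // => /eqP e.
  have n0 : 0 < n by exact: leq_ltn_trans (ltn_ord j).
  have ei : i = i'.
    apply: val_inj; have := congr1 (divn^~ n) e.
    by rewrite !divnMDl // !divn_small // !addn0.
  by subst i'; move/addnI: e => /val_inj->.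
move=> [i j] [i' j'] /andP[/= /eqP<-] /orP[]/eqP/= e.
  by have := lt_idx i j'; rewrite /= e addnS; exact: ps.
by rewrite adj_sym; have := lt_idx i j; rewrite /= e addnS; exact: ps.
Qed.

(** * The lower bound *)

Section IsolatedPlusClique.
Variable M : nat.
(** Vertex [0] is isolated, so the complement is a star centred at [0]. *)
Definition iso_clique_adj : rel 'I_M :=
  [rel i j : 'I_M | [&& i != j, 0 < i & 0 < j]].
Fact iso_clique_sym : symmetric iso_clique_adj.
Proof. by move=> i j; rewrite /iso_clique_adj /= eq_sym [(0 < i) && _]andbC. Qed.
Fact iso_clique_irr : irreflexive iso_clique_adj.
Proof. by move=> i; rewrite /iso_clique_adj /= eqxx. Qed.
Definition iso_clique : sgraph := SGraph iso_clique_sym iso_clique_irr.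

(** By cardinality an embedding would be bijective and so hit the isolated vertex [0], whereas every
    vertex of a path on at least two vertices has a neighbour. *)
Lemma iso_clique_no_copies n k : 2 <= n -> 1 <= k -> M <= k * n ->
  ~ contains_subgraph iso_clique (copies k (path_graph n)).
Proof.
move=> n2 k1 leM [f [f_inj f_adj]].
have leC : #|iso_clique| <= #|copies k (path_graph n)|.
  by rewrite /= card_prod !card_ord.
have M0 : 0 < M.
  exact: leq_ltn_trans (ltn_ord (f (Ordinal k1, Ordinal (ltnW n2)))).
have [f' _ f'K] := inj_card_bij f_inj leC.
case E: (f' (Ordinal M0)) => [i j].
suff [v uv] : exists v : copies k (path_graph n), adj (f' (Ordinal M0)) v.
  by have := f_adj _ _ uv; rewrite f'K => /and3P[].
rewrite E; case: j {E} => [[|j] lj].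
  by exists (i, Ordinal n2); apply/andP; rewrite /= eqxx.
by exists (i, Ordinal (ltnW lj)); apply/andP; split=> //; apply/orP; right; exact: eqxx.
Qed.

(** All edges of a star share its centre, but the 4-cycle has two disjoint edges. *)
Lemma iso_clique_no_jahangir :
  ~ contains_subgraph (complement iso_clique) (jahangir 2).
Proof.
move=> [f [f_inj f_adj]].
have centre x y : adj x y -> f x = 0 :> nat \/ f y = 0 :> nat.
  case/f_adj/andP=> ne /nandP[/negP[] //|/nandP[]]; rewrite -eqn0Ngt => /eqP.
    by left.
  by right.
have same x y : f x = 0 :> nat -> f y = 0 :> nat -> x = y.
  by move=> ex ey; apply: f_inj; apply: val_inj; rewrite /= ex ey.
pose v i (lti : i < 4) : jahangir 2 := Some (Ordinal lti).
have [e|e] := centre (v 0 isT) (v 1 isT) isT;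
  by have [e'|e'] := centre (v 2 isT) (v 3 isT) isT; have := same _ _ e e'.
Qed.
End IsolatedPlusClique.

Theorem theorem2 (n k : nat) (hn : 4 <= n) (hk : 1 <= k)
    (hnk : (n, k) <> (4, 1)) :
  is_ramsey_number (copies k (path_graph n)) (jahangir 2) (k * n + 1).
Proof.
split=> [F cF|M arrow]; last first.
  rewrite leqNgt addn1 ltnS; apply/negP=> leM.
  have [] := arrow (iso_clique M) (card_ord M).
    by apply: iso_clique_no_copies => //; exact: leq_trans hn.
  exact: iso_clique_no_jahangir.
(* If [k] is at least 2, then [k * n] is at least 8. If [k] is 1, excluding [(4, 1)] leaves [n] at
   least 5. *)
have le6 : 6 <= #|F|.
  rewrite cF; case: k hk hnk {cF} => [|[|k]] // _; last by nia.
  by case: n hn => [|[|[|[|[|n]]]]] //; lia.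
have [/existsP[a /existsP[b /existsP[c /existsP[d /existsP[e K]]]]]|no] :=
  boolP [exists a, exists b, exists c, exists d, exists e, @nonadj_K23 F a b c d e].
  by right; exact: nonadj_K23_jahangir K.
left; have [s path_s max_s] := longest_path_exists F.
have [x0 _] : exists x : F, x \in predT by apply/card_gt0P; exact: leq_trans le6.
have noK23 (a b c d e : F) : ~~ nonadj_K23 a b c d e.
  by apply: contra no => K; do 5![apply/existsP; eexists]; exact: K.
apply: (path_contains_copies x0 path_s).
have := longest_path_misses_one noK23 path_s max_s le6.
by rewrite cF addn1.
Qed.
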